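(* Let $\boldsymbol A(\mathfrak C)=\mathfrak C^*$ be a regular (branched or unbranched) covering, $\mathfrak C$ connected, $\mathfrak C^*$ with a single point; let $p_0$ be a point of $\mathfrak C$, $\mathfrak W_0$ the fundamental group of $\mathfrak C$ with basepoint $p_0$, $\mathfrak T$ the group of mappings of $\mathfrak C$ onto itself belonging to the covering, $\mathfrak A$ the group of automorphisms of $\mathfrak W_0$ determined by $\mathfrak T$, $\mathfrak V$ the principal group of the covering, and $\mathfrak U\cong\mathfrak W_0$ the invariant subgroup of $\mathfrak V$ belonging to the covering. The groups $\mathfrak A$ and $\mathfrak V$ are isomorphic when 1. each transformation $T$ in $\mathfrak T$ different from the identity induces an automorphism which is not an inner automorphism, and 2. the center of $\mathfrak U$ consists only of the identity element.
   Context: A line segment complex consists of (finitely or denumerably many) points and directed segments; each segment $s$ has an initial and a final point and an oppositely directed segment $s^{-1}\ne s$, with $(s^{-1})^{-1}=s$, whose initial (final) point is the final (initial) point of $s$. Paths are finite sequences of segments, each beginning where the preceding one ends. A surface complex is a line segment complex together with surface pieces $f$; each $f$ has an opposite $f^{-1}\neq f$, $(f^{-1})^{-1}=f$, and a closed path, determined up to cyclic interchange, circumscribing $f$ once positively (a simple positive boundary path of $f$); if $w$ is one for $f$, then $w^{-1}$ is one for $f^{-1}$. The fundamental group of a connected surface complex consists of classes $[w]$ of closed paths from a basepoint modulo insertion and deletion of $ss^{-1}$ and of simple boundary paths of surface pieces. Covering (possibly branched) $\boldsymbol A(\mathfrak C)=\mathfrak C^*$ of surface complexes: a map of points, segments,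 surface pieces, surjective on points, such that (a) initial points are preserved, $\boldsymbol A(s^{-1})=\boldsymbol A(s)^{-1}$, $\boldsymbol A(f^{-1})=\boldsymbol A(f)^{-1}$, and the segments beginning at $p$ are mapped bijectively onto those beginning at $\boldsymbol A(p)$; (b) if $r$ is a simple positive boundary path of $f$, then $\boldsymbol A(r)={r^*}^k$ for a simple positive boundary path $r^*$ of $\boldsymbol A(f)$, and, writing $r=w_1\cdots w_k$ with $\boldsymbol A(w_i)=r^*$, the $w_i$ are pairwise distinct; (c) if $r^*$ is a simple positive boundary path of $f^*$ and $w'$ is a path with $\boldsymbol A(w')=r^*$, there is exactly one surface piece $f'$ over $f^*$ in whose simple positive boundary path $r'$ (suitably cyclically interchanged) $w'$ occurs as initial subpath. In $\mathfrak C^*$ each simple positive boundary path of a surface piece $f^*$ is assumed to bound only this surface piece positively. The covering is regular if, whenever $\boldsymbol A(w)=\boldsymbol A(w')$ and the path $w$ is closed, $w'$ is closed. $\mathfrak T$ is the group of automorphisms of the line segment complex of $\mathfrak C$ (which extend to $\mathfrak C$) that carry every element to one lying over the same element of $\mathfrak C^*$. The automorphisms determined by $\mathfrak T$: for $T\in\mathfrak T$ and a path $h$ from $p_0$ to $T(p_0)$, $[w]\mapsto[h\,T(w)\,h^{-1}]$ is an automorphism of $\mathfrak W_0$; the different choices of $h$ give a residue class modulo the inner automorphisms, and $T$ is said to induce each of these automorphisms. $\mathfrak A$ is the group of all automorphisms so obtained for all $T\in\mathfrak T$ and all $h$. The universal covering complex $\mathfrak K$ of $\mathfrak C$, with covering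 $\boldsymbol A'$, is the connected unbranched covering complex in which a path is closed iff its image in $\mathfrak C$ is closed and represents the identity of the fundamental group of $\mathfrak C$. Let $\boldsymbol A''=\boldsymbol A\circ\boldsymbol A'$, a regular covering of $\mathfrak C^*$. If $s_1^{*\pm1},s_2^{*\pm1},\dots$ are the segments of $\mathfrak C^*$, the principal group $\mathfrak V$ is the factor group of the free group on $S_1,S_2,\dots$ by the normal subgroup of those words $W(S)$ for which the paths of $\mathfrak K$ lying over $W(s^* )$ are closed; $\mathfrak U$ consists of the elements of $\mathfrak V$ represented by words $w^*(S)$ where $w^*(s^* )=\boldsymbol A''(w)$ for some path $w$ of $\mathfrak K$ beginning and ending at points $p$ with $\boldsymbol A'(p)=p_0$. *)

(* Defs.v *)
From HB Require Import structures.
From Stdlib Require Import Relation_Operators.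
From mathcomp Require Import all_boot generic_quotient.
From mathcomp Require Import boolp classical_sets.

Local Open Scope quotient_scope.

Set Implicit Arguments.
Unset Strict Implicit.
Unset Printing Implicit Defensive.

(* A group given by representatives up to an equivalence relation.  It is only
   used to build the quotient [quotGroup] below. *)
Record groupSetoid := GroupSetoid {
  gs_sort :> choiceType;
  gs_rel : gs_sort -> gs_sort -> Prop;
  gs_mul : gs_sort -> gs_sort -> gs_sort;
  gs_one : gs_sort;
  gs_inv : gs_sort -> gs_sort;
  gs_refl : forall x, gs_rel x x;
  gs_sym : forall x y, gs_rel x y -> gs_rel y x;
  gs_trans : forall x y z, gs_rel x y -> gs_rel y z -> gs_rel x z;
  gs_mul_rel : forall x x' y y',
    gs_rel x x' -> gs_rel y y' -> gs_rel (gs_mul x y) (gs_mul x' y');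
  gs_mulA : forall x y z,
    gs_rel (gs_mul x (gs_mul y z)) (gs_mul (gs_mul x y) z);
  gs_mul1 : forall x, gs_rel (gs_mul gs_one x) x;
  gs_1mul : forall x, gs_rel (gs_mul x gs_one) x;
  gs_mulVx : forall x, gs_rel (gs_mul (gs_inv x) x) gs_one;
  gs_mulxV : forall x, gs_rel (gs_mul x (gs_inv x)) gs_one }.

Section QuotGroup.
Variable S : groupSetoid.

Definition gs_relb (x y : S) : bool := `[< gs_rel x y >].

Lemma gs_relb_equiv : equiv_class_of gs_relb.
Proof.
split=> [x|x y|y x z].
- exact/asboolP/gs_refl.
- by apply/asboolP/asboolP => /gs_sym.
- by move=> /asboolP h1 /asboolP h2; apply/asboolP/(gs_trans h1).
Qed.

Canonical gs_relb_equiv_rel := EquivRelPack gs_relb_equiv.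

Definition quotGroup : Type := {eq_quot gs_relb_equiv_rel}.
HB.instance Definition _ := Choice.on quotGroup.

Definition gclass (x : S) : quotGroup := \pi_({eq_quot gs_relb_equiv_rel}) x.

Lemma gclassP (x y : S) : gclass x = gclass y <-> gs_rel x y.
Proof.
split; first by move=> /eqmodP /asboolP.
by move=> h; apply/eqmodP/asboolP.
Qed.

Definition grepr (x : quotGroup) : S := @repr S {eq_quot gs_relb_equiv_rel} x.
Lemma greprK x : gclass (grepr x) = x. Proof. exact: reprK. Qed.

Definition quot_mul (x y : quotGroup) := gclass (gs_mul (grepr x) (grepr y)).
Definition quot_one : quotGroup := gclass (gs_one S).
Definition quot_inv (x : quotGroup) := gclass (gs_inv (grepr x)).

Lemma quot_mulE a b : quot_mul (gclass a) (gclass b) = gclass (gs_mul a b).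
Proof. by apply/gclassP/gs_mul_rel; apply/gclassP; rewrite greprK. Qed.

Lemma quot_mulA : associative quot_mul.
Proof.
move=> x y z; rewrite -(greprK x) -(greprK y) -(greprK z) !quot_mulE.
exact/gclassP/gs_mulA.
Qed.

Lemma quot_mul1 : left_id quot_one quot_mul.
Proof. by move=> x; rewrite -(greprK x) quot_mulE; exact/gclassP/gs_mul1. Qed.

Lemma quot_1mul : right_id quot_one quot_mul.
Proof. by move=> x; rewrite -(greprK x) quot_mulE; exact/gclassP/gs_1mul. Qed.

Lemma quot_mulVx : left_inverse quot_one quot_inv quot_mul.
Proof.
by move=> x; rewrite -{2}(greprK x) quot_mulE; exact/gclassP/gs_mulVx.
Qed.

Lemma quot_mulxV : right_inverse quot_one quot_inv quot_mul.
Proof.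
by move=> x; rewrite -{1}(greprK x) quot_mulE; exact/gclassP/gs_mulxV.
Qed.

HB.instance Definition _ := isGroup.Build quotGroup
  quot_mulA quot_mul1 quot_1mul quot_mulVx quot_mulxV.
End QuotGroup.

Local Open Scope group_scope.
Local Open Scope classical_set_scope.

Definition isomorphic (G H : groupType) : Prop :=
  exists f : G -> H, bijective f /\ {morph f : x y / x * y}.

Definition center (G : groupType) (H : set G) : set G :=
  [set x | H x /\ forall y, H y -> commute x y].

Record normalSubgroup (G : groupType) := NormalSubgroup {
  ns_mem :> G -> Prop;
  ns_one : ns_mem 1;
  ns_mul : forall x y, ns_mem x -> ns_mem y -> ns_mem (x * y);
  ns_inv : forall x, ns_mem x -> ns_mem x^-1;
  ns_conj : forall x y, ns_mem x -> ns_mem (y * x * y^-1) }.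

Section FactorGroup.
Variables (G : groupType) (N : normalSubgroup G).

Let eqN (x y : G) : Prop := N (x * y^-1).

Let eqN_refl x : eqN x x.
Proof. by rewrite /eqN mulgV; exact: ns_one. Qed.

Let eqN_sym x y : eqN x y -> eqN y x.
Proof. by move=> /ns_inv; rewrite /eqN invgF. Qed.

Let eqN_trans x y z : eqN x y -> eqN y z -> eqN x z.
Proof. by move=> h1 h2; have := ns_mul h1 h2; rewrite mulgA mulgVK. Qed.

Let eqN_mul x x' y y' : eqN x x' -> eqN y y' -> eqN (x * y) (x' * y').
Proof.
move=> h1 h2; have := ns_mul (ns_conj x h2) h1.
by rewrite /eqN invgM !mulgA mulgVK.
Qed.

Let eqN_eq x y : x = y -> eqN x y.
Proof. by move=> ->; exact: eqN_refl. Qed.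

Definition factorSetoid : groupSetoid :=
  @GroupSetoid G eqN (fun x y => x * y) 1 (fun x => x^-1)
    eqN_refl eqN_sym eqN_trans eqN_mul
    (fun x y z => eqN_eq (mulgA x y z)) (fun x => eqN_eq (mul1g x))
    (fun x => eqN_eq (mulg1 x)) (fun x => eqN_eq (mulVg x))
    (fun x => eqN_eq (mulgV x)).

Definition factorGroup : groupType := quotGroup factorSetoid.
Definition fclass (x : G) : factorGroup := @gclass factorSetoid x.
End FactorGroup.

Section FreeGroup.
Variable I : countType.

(* The letter [(i, false)] is the generator S_i, [(i, true)] its inverse. *)
Definition letter : Type := (I * bool)%type.
HB.instance Definition _ := Countable.on letter.
Definition letterV (x : letter) : letter := (x.1, ~~ x.2).
Definition wordV (w : seq letter) : seq letter := rev (map letterV w).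

Inductive cancel_word : seq letter -> seq letter -> Prop :=
  | CancelWord u x v : cancel_word (u ++ [:: x; letterV x] ++ v) (u ++ v).

Let eqF := clos_refl_sym_trans _ cancel_word.

Let letterVK x : letterV (letterV x) = x.
Proof. by case: x => i b; rewrite /letterV /= negbK. Qed.

Let eqF_catl u w w' : eqF w w' -> eqF (u ++ w) (u ++ w').
Proof.
elim=> [_ _ [a x b]|x|x y _ h|x y z _ h1 _ h2].
- by rewrite !(catA u); exact/rst_step/CancelWord.
- exact: rst_refl.
- exact: rst_sym.
- exact: rst_trans h1 h2.
Qed.

Let eqF_catr u w w' : eqF w w' -> eqF (w ++ u) (w' ++ u).
Proof.
elim=> [_ _ [a x b]|x|x y _ h|x y z _ h1 _ h2].
- by rewrite -!catA; exact/rst_step/CancelWord.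
- exact: rst_refl.
- exact: rst_sym.
- exact: rst_trans h1 h2.
Qed.

Let eqF_cat x x' y y' : eqF x x' -> eqF y y' -> eqF (x ++ y) (x' ++ y').
Proof.
by move=> h1 h2; apply: rst_trans (eqF_catr y h1) (eqF_catl x' h2).
Qed.

Let eqF_mulV w : eqF (w ++ wordV w) [::].
Proof.
elim/last_ind: w => [|w x IH]; first exact: rst_refl.
rewrite /wordV map_rcons rev_rcons -cats1 -catA; apply: rst_trans IH.
exact/rst_step/(CancelWord w x (wordV w)).
Qed.

Let eqF_Vmul w : eqF (wordV w ++ w) [::].
Proof.
rewrite -{2}[w](_ : wordV (wordV w) = w); first exact: eqF_mulV.
by rewrite /wordV map_rev revK -map_comp -[RHS]map_id; apply: eq_map.
Qed.

Let eqF_eq w w' : w = w' -> eqF w w'.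
Proof. by move=> ->; exact: rst_refl. Qed.

Definition freeSetoid : groupSetoid :=
  @GroupSetoid (seq letter) eqF (fun u v => u ++ v) [::] wordV
    (fun x => rst_refl _ _ x) (fun x y => @rst_sym _ _ x y)
    (fun x y z => @rst_trans _ _ x y z) eqF_cat
    (fun x y z => eqF_eq (catA x y z)) (fun x => eqF_eq (cat0s x))
    (fun x => eqF_eq (cats0 x)) eqF_Vmul eqF_mulV.

Definition freeGroup : groupType := quotGroup freeSetoid.
Definition word_class (w : seq letter) : freeGroup := @gclass freeSetoid w.
End FreeGroup.

Record automorphism (G : groupType) := Automorphism {
  aut_fun :> G -> G;
  aut_bij : bijective aut_fun;
  aut_morph : {morph aut_fun : x y / x * y} }.

Section AutomorphismGroup.
Variable G : groupType.

HB.instance Definition _ := gen_eqMixin (automorphism G).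
HB.instance Definition _ := gen_choiceMixin (automorphism G).

Lemma aut_eqP (a b : automorphism G) : aut_fun a =1 aut_fun b -> a = b.
Proof.
case: a b => [a a1 a2] [b b1 b2] /= /funext ab.
by case: _ / ab in b1 b2 *; congr Automorphism; exact: Prop_irrelevance.
Qed.

Definition aut_one : automorphism G :=
  @Automorphism G id (@Bijective _ _ id id (fun=> erefl) (fun=> erefl))
    (fun _ _ => erefl).

Let comp_morph (a b : automorphism G) : {morph a \o b : x y / x * y}.
Proof. by move=> x y /=; rewrite !aut_morph. Qed.

Definition aut_mul (a b : automorphism G) : automorphism G :=
  Automorphism (bij_comp (aut_bij a) (aut_bij b)) (@comp_morph a b).

Let aut_inv_ex (a : automorphism G) :
  exists b : automorphism G, cancel b a /\ cancel a b.
Proof.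
have [g ga ag] := aut_bij a.
have gm : {morph g : x y / x * y}.
  by move=> x y; rewrite -[x in LHS]ag -[y in LHS]ag -aut_morph ga.
by exists (Automorphism (Bijective ag ga) gm).
Qed.

Definition aut_inv (a : automorphism G) : automorphism G :=
  sval (cid (aut_inv_ex a)).

Lemma aut_invK (a : automorphism G) : cancel (aut_inv a) a.
Proof. by rewrite /aut_inv; case: cid => b []. Qed.

Lemma autK_inv (a : automorphism G) : cancel a (aut_inv a).
Proof. by rewrite /aut_inv; case: cid => b []. Qed.

Let aut_mulA : associative aut_mul. Proof. by move=> a b c; exact: aut_eqP. Qed.
Let aut_mul1 : left_id aut_one aut_mul. Proof. by move=> a; exact: aut_eqP. Qed.
Let aut_1mul : right_id aut_one aut_mul.
Proof. by move=> a; exact: aut_eqP. Qed.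
Let aut_mulVx : left_inverse aut_one aut_inv aut_mul.
Proof. by move=> a; apply: aut_eqP => x /=; rewrite autK_inv. Qed.
Let aut_mulxV : right_inverse aut_one aut_inv aut_mul.
Proof. by move=> a; apply: aut_eqP => x /=; rewrite aut_invK. Qed.

HB.instance Definition _ := isGroup.Build (automorphism G)
  aut_mulA aut_mul1 aut_1mul aut_mulVx aut_mulxV.

Definition inner (a : automorphism G) : Prop :=
  exists g : G, forall x, a x = g * x * g^-1.
End AutomorphismGroup.

Record lineComplex := LineComplex {
  pt : countType;
  segment : countType;
  initial : segment -> pt;
  final : segment -> pt;
  sinv : segment -> segment;
  sinvK : involutive sinv;
  sinv_neq : forall s, sinv s != s;
  initial_sinv : forall s, initial (sinv s) = final s }.

Lemma final_sinv (L : lineComplex) (s : segment L) :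
  final (sinv s) = initial s.
Proof. by rewrite -initial_sinv sinvK. Qed.

(* A path is given by its initial point [p] together with its list of segments,
   so that every point [p] carries an empty path. *)
Section Paths.
Variable L : lineComplex.
Implicit Types (p : pt L) (w u v : seq (segment L)).

Fixpoint is_path p w : bool :=
  if w is s :: w' then (initial s == p) && is_path (final s) w' else true.

Definition endpoint p w : pt L := last p (map (@final L) w).

Definition is_closed p w : bool := is_path p w && (endpoint p w == p).

Definition pathV w : seq (segment L) := rev (map (@sinv L) w).

Definition connected : Prop :=
  forall p q, exists w, is_path p w /\ endpoint p w = q.

Lemma endpoint_cat p u v : endpoint p (u ++ v) = endpoint (endpoint p u) v.
Proof. by rewrite /endpoint map_cat last_cat. Qed.

Lemma is_path_cat p u v :
  is_path p (u ++ v) = is_path p u && is_path (endpoint p u) v.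
Proof. by elim: u p => //= s u IH p; rewrite IH andbA. Qed.

Lemma pathVK w : pathV (pathV w) = w.
Proof.
rewrite /pathV map_rev revK -map_comp -[RHS]map_id.
by apply: eq_map => s /=; rewrite sinvK.
Qed.

Lemma is_pathV p w : is_path p w ->
  is_path (endpoint p w) (pathV w) && (endpoint (endpoint p w) (pathV w) == p).
Proof.
elim: w p => [|s w IH] p /=; first by rewrite /endpoint eqxx.
move=> /andP[/eqP <- /IH /andP[h1 /eqP h2]].
rewrite /pathV /= rev_cons -cats1 is_path_cat endpoint_cat.
have -> : endpoint (initial s) (s :: w) = endpoint (final s) w by [].
by rewrite -/(pathV w) h1 h2 /= /endpoint /= initial_sinv final_sinv !eqxx.
Qed.
End Paths.

Arguments connected : clear implicits.

Record surfaceComplex := SurfaceComplex {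
  lines :> lineComplex;
  piece : Type;
  pinv : piece -> piece;
  pinvK : involutive pinv;
  pinv_neq : forall f, pinv f <> f;
  (* [bounds f p r]: the path [r] from [p] is a simple positive boundary path
     of the surface piece [f] *)
  bounds : piece -> pt lines -> seq (segment lines) -> Prop;
  bounds_ex : forall f, exists p r, bounds f p r;
  bounds_closed : forall f p r, bounds f p r -> is_closed p r;
  bounds_rot : forall f p r, bounds f p r -> forall q r',
    bounds f q r' <->
    exists2 n, n <= size r & q = endpoint p (take n r) /\ r' = rot n r;
  bounds_inv : forall f p r, bounds f p r -> bounds (pinv f) p (pathV r) }.

Definition boundary_determines_piece (C : surfaceComplex) : Prop :=
  forall (f g : piece C) p r, bounds f p r -> bounds g p r -> f = g.

Section FundamentalGroup.
Variables (C : surfaceComplex) (p0 : pt C).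

Definition loop : Type := {w : seq (segment C) | is_closed p0 w}.
HB.instance Definition _ := Choice.on loop.

Inductive deletion : seq (segment C) -> seq (segment C) -> Prop :=
  | DeleteSpur u s v : deletion (u ++ [:: s; sinv s] ++ v) (u ++ v)
  | DeleteBoundary u f q r v : bounds f q r -> deletion (u ++ r ++ v) (u ++ v).

Definition homotopic : loop -> loop -> Prop :=
  clos_refl_sym_trans loop (fun a b => deletion (val a) (val b)).

Let loop_nil_proof : is_closed p0 [::]. Proof. exact: eqxx. Qed.
Definition loop_nil : loop := Sub [::] loop_nil_proof.

Let loop_cat_proof (a b : loop) : is_closed p0 (val a ++ val b).
Proof.
have /andP[a1 /eqP a2] := valP a; have /andP[b1 /eqP b2] := valP b.
by rewrite /is_closed is_path_cat endpoint_cat a1 a2 b1 b2 /=.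
Qed.
Definition loop_cat (a b : loop) : loop := Sub _ (loop_cat_proof a b).

Let loop_inv_proof (a : loop) : is_closed p0 (pathV (val a)).
Proof. by have /andP[/is_pathV + /eqP a2] := valP a; rewrite a2. Qed.
Definition loop_inv (a : loop) : loop := Sub _ (loop_inv_proof a).

Let hom_catl c a b : homotopic a b -> homotopic (loop_cat c a) (loop_cat c b).
Proof.
elim=> [x y xy|x|x y _ h|x y z _ h1 _ h2].
- apply: rst_step => /=; case: xy => [u s v|u f q r v h];
    rewrite !(catA (val c)).
    exact: DeleteSpur.
  exact: DeleteBoundary h.
- exact: rst_refl.
- exact: rst_sym.
- exact: rst_trans h1 h2.
Qed.

Let hom_catr c a b : homotopic a b -> homotopic (loop_cat a c) (loop_cat b c).
Proof.
elim=> [x y xy|x|x y _ h|x y z _ h1 _ h2].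
- apply: rst_step => /=; case: xy => [u s v|u f q r v h]; rewrite -!catA.
    exact: DeleteSpur.
  exact: DeleteBoundary h.
- exact: rst_refl.
- exact: rst_sym.
- exact: rst_trans h1 h2.
Qed.

Let hom_cat a a' b b' :
  homotopic a a' -> homotopic b b' -> homotopic (loop_cat a b) (loop_cat a' b').
Proof. by move=> h1 h2; apply: rst_trans (hom_catr b h1) (hom_catl a' h2). Qed.

Let hom_eq (a b : loop) : val a = val b -> homotopic a b.
Proof. by move=> /val_inj ->; exact: rst_refl. Qed.

Lemma homotopic_spur w (b : loop) :
  is_path p0 w -> val b = w ++ pathV w -> homotopic b loop_nil.
Proof.
elim/last_ind: w b => [|w s IH] b hw hb; first exact: hom_eq.
have hw' : is_path p0 w by move: hw; rewrite -cats1 is_path_cat => /andP[].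
have hc : is_closed p0 (w ++ pathV w).
  have /andP[h1 /eqP h2] := is_pathV hw'.
  by rewrite /is_closed is_path_cat endpoint_cat hw' h1 h2 /=.
apply: rst_trans (IH (Sub _ hc) hw' erefl); apply: rst_step => /=.
rewrite hb /pathV map_rcons rev_rcons -cats1 -catA.
exact: (DeleteSpur w s).
Qed.

Let hom_mulV a : homotopic (loop_cat a (loop_inv a)) loop_nil.
Proof. by apply: (@homotopic_spur (val a)) => //; have /andP[] := valP a. Qed.

Let hom_Vmul a : homotopic (loop_cat (loop_inv a) a) loop_nil.
Proof.
apply: rst_trans (hom_mulV (loop_inv a)); apply: hom_eq => /=.
by rewrite pathVK.
Qed.

Let hom_catA a b c :
  homotopic (loop_cat a (loop_cat b c)) (loop_cat (loop_cat a b) c).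
Proof. by apply: hom_eq; rewrite /= catA. Qed.

Let hom_cat0 a : homotopic (loop_cat loop_nil a) a.
Proof. exact: hom_eq. Qed.

Let hom_0cat a : homotopic (loop_cat a loop_nil) a.
Proof. by apply: hom_eq; rewrite /= cats0. Qed.

Definition pi1Setoid : groupSetoid :=
  @GroupSetoid loop homotopic loop_cat loop_nil loop_inv
    (fun x => rst_refl _ _ x) (fun x y => @rst_sym _ _ x y)
    (fun x y z => @rst_trans _ _ x y z) hom_cat hom_catA hom_cat0 hom_0cat
    hom_Vmul hom_mulV.

Definition pi1 : groupType := quotGroup pi1Setoid.
Definition loop_class (w : loop) : pi1 := @gclass pi1Setoid w.
End FundamentalGroup.

Record lineCovering (L M : lineComplex) := LineCovering {
  cpoint : pt L -> pt M;
  cseg : segment L -> segment M;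
  cpoint_surj : forall q, exists p, cpoint p = q;
  cseg_initial : forall s, initial (cseg s) = cpoint (initial s);
  cseg_sinv : forall s, cseg (sinv s) = sinv (cseg s);
  cseg_star : forall p t, initial t = cpoint p ->
    exists! s, initial s = p /\ cseg s = t }.

Record covering (C D : surfaceComplex) := Covering {
  cov_lines :> lineCovering C D;
  cpiece : piece C -> piece D;
  cpiece_pinv : forall f, cpiece (pinv f) = pinv (cpiece f);
  (* [r] maps onto the [size ws]-th power of [r'], and [ws] are the
     subpaths of [r] lying over the successive factors [r'] *)
  cov_boundary : forall f p r, bounds f p r ->
    exists r' ws, [/\ bounds (cpiece f) (cpoint cov_lines p) r',
      0 < size ws, r = flatten ws,
      (forall w, w \in ws -> map (cseg cov_lines) w = r') & uniq ws];
  cov_piece_lift : forall g q r', bounds g q r' ->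
    forall p w, is_path p w -> cpoint cov_lines p = q ->
    map (cseg cov_lines) w = r' ->
    exists! f, cpiece f = g /\ exists v, bounds f p (w ++ v) }.

(* Every exponent [size ws] in [cov_boundary] is 1. *)
Definition unbranched (C D : surfaceComplex) (A : covering C D) : Prop :=
  forall (f : piece C) p r, bounds f p r ->
    bounds (cpiece A f) (cpoint A p) (map (cseg A) r).

Definition regular (L M : lineComplex) (A : lineCovering L M) : Prop :=
  forall p w p' w', is_path p w -> is_path p' w' ->
    cpoint A p = cpoint A p' -> map (cseg A) w = map (cseg A) w' ->
    is_closed p w -> is_closed p' w'.

Section Composition.
Variables (K L M : lineComplex) (A : lineCovering L M) (B : lineCovering K L).

Let comp_surj q : exists p, (cpoint A \o cpoint B) p = q.
Proof.
have [p <-] := cpoint_surj A q; have [p' <-] := cpoint_surj B p.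
by exists p'.
Qed.

Let comp_initial s :
  initial ((cseg A \o cseg B) s) = (cpoint A \o cpoint B) (initial s).
Proof. by rewrite /= !cseg_initial. Qed.

Let comp_sinv s : (cseg A \o cseg B) (sinv s) = sinv ((cseg A \o cseg B) s).
Proof. by rewrite /= !cseg_sinv. Qed.

Let comp_star p t : initial t = (cpoint A \o cpoint B) p ->
  exists! s, initial s = p /\ (cseg A \o cseg B) s = t.
Proof.
move=> /cseg_star [s1 [[i1 e1] u1]].
have [s2 [[i2 e2] u2]] := cseg_star i1.
exists s2; split=> [|s [i3 e3]]; first by rewrite /= e2.
apply: u2; split=> //; symmetry; apply: u1; split=> //.
by rewrite cseg_initial i3.
Qed.

Definition comp_cov : lineCovering K M :=
  LineCovering comp_surj comp_initial comp_sinv comp_star.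
End Composition.

Definition universal_covering (K C : surfaceComplex)
    (A : covering K C) : Prop :=
  [/\ connected K, unbranched A &
    forall (p : pt K) w, is_path p w ->
      (is_closed p w <->
       exists c : loop (cpoint A p),
         val c = map (cseg A) w /\ loop_class c = 1)].

Record deck (L M : lineComplex) (A : lineCovering L M) := Deck {
  dpoint : pt L -> pt L;
  dseg : segment L -> segment L;
  dpoint_bij : bijective dpoint;
  dseg_bij : bijective dseg;
  dseg_initial : forall s, initial (dseg s) = dpoint (initial s);
  dseg_sinv : forall s, dseg (sinv s) = sinv (dseg s);
  dpoint_over : forall p, cpoint A (dpoint p) = cpoint A p;
  dseg_over : forall s, cseg A (dseg s) = cseg A s }.

Definition is_identity (L M : lineComplex) (A : lineCovering L M)
    (T : deck A) : Prop :=
  dpoint T =1 id /\ dseg T =1 id.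

Section DeckPaths.
Variables (L M : lineComplex) (A : lineCovering L M).

Lemma dseg_final (T : deck A) s : final (dseg T s) = dpoint T (final s).
Proof. by rewrite -!initial_sinv -dseg_sinv dseg_initial. Qed.

Lemma deck_path (T : deck A) p w :
  is_path p w -> is_path (dpoint T p) (map (dseg T) w).
Proof.
elim: w p => //= s w IH p /andP[/eqP <- /IH].
by rewrite dseg_initial dseg_final eqxx.
Qed.

Lemma deck_endpoint (T : deck A) p w :
  endpoint (dpoint T p) (map (dseg T) w) = dpoint T (endpoint p w).
Proof.
by elim: w p => //= s w IH p; rewrite /endpoint /= dseg_final; exact: IH.
Qed.

Lemma deck_pathV (T : deck A) w :
  map (dseg T) (pathV w) = pathV (map (dseg T) w).
Proof.
rewrite /pathV map_rev -!map_comp; congr rev.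
by apply: eq_map => s /=; rewrite dseg_sinv.
Qed.

Lemma deck_id_ex : exists T : deck A, is_identity T.
Proof.
have b (X : Type) : bijective (@id X) by exists id.
by exists (@Deck L M A id id (b _) (b _) (fun _ => erefl) (fun _ => erefl)
  (fun _ => erefl) (fun _ => erefl)).
Qed.

Lemma deck_comp_ex (T U : deck A) : exists V : deck A,
  dpoint V =1 dpoint T \o dpoint U /\ dseg V =1 dseg T \o dseg U.
Proof.
unshelve eexists (@Deck L M A (dpoint T \o dpoint U) (dseg T \o dseg U)
  (bij_comp (dpoint_bij T) (dpoint_bij U))
  (bij_comp (dseg_bij T) (dseg_bij U)) _ _ _ _) => //= s.
- by rewrite !dseg_initial.
- by rewrite !dseg_sinv.
- by rewrite !dpoint_over.
- by rewrite !dseg_over.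
Qed.

Lemma deck_inv_ex (T : deck A) : exists V : deck A,
  [/\ cancel (dpoint T) (dpoint V), cancel (dpoint V) (dpoint T),
      cancel (dseg T) (dseg V) & cancel (dseg V) (dseg T)].
Proof.
have [f Tf fT] := dpoint_bij T; have [g Tg gT] := dseg_bij T.
unshelve eexists (@Deck L M A f g (Bijective fT Tf) (Bijective gT Tg) _ _ _ _)
  => //= s.
- by apply: (can_inj Tf); rewrite -dseg_initial gT fT.
- by apply: (can_inj Tg); rewrite dseg_sinv !gT.
- by rewrite -[in RHS](fT s) dpoint_over.
- by rewrite -[in RHS](gT s) dseg_over.
Qed.
End DeckPaths.

Section InducedAutomorphisms.
Variables (C D : surfaceComplex) (A : covering C D) (p0 : pt C).

Lemma conj_loop_proof (T : deck A) (h : seq (segment C)) :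
  is_path p0 h -> endpoint p0 h = dpoint T p0 -> forall w : loop p0,
  is_closed p0 (h ++ map (dseg T) (val w) ++ pathV h).
Proof.
move=> h1 h2 w; have /andP[w1 /eqP w2] := valP w.
have /andP[v1 v2] := is_pathV h1.
rewrite /is_closed !is_path_cat !endpoint_cat h1 h2 deck_path //.
by rewrite deck_endpoint w2 -h2 v1 v2.
Qed.

Definition conj_loop (T : deck A) (h : seq (segment C))
    (h1 : is_path p0 h) (h2 : endpoint p0 h = dpoint T p0) (w : loop p0) :
    loop p0 :=
  Sub _ (conj_loop_proof h1 h2 w).

Definition induces (T : deck A) (a : automorphism (pi1 p0)) : Prop :=
  exists h (h1 : is_path p0 h) (h2 : endpoint p0 h = dpoint T p0),
    forall w : loop p0, a (loop_class w) = loop_class (conj_loop h1 h2 w).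

Definition induced : {pred automorphism (pi1 p0)} :=
  fun a => `[< exists T : deck A, induces T a >].

Lemma loop_class_surj (x : pi1 p0) : exists w, x = loop_class w.
Proof. by exists (@grepr (pi1Setoid p0) x); rewrite /loop_class greprK. Qed.

Lemma induced_group_closed : group_closed induced.
Proof.
have ind1 : 1 \in induced.
  apply/asboolP; have [T [T1 T2]] := deck_id_ex A.
  exists T, [::], isT, (esym (T1 p0)) => w; congr loop_class; apply: val_inj.
  by rewrite /= cats0 (eq_map T2) map_id.
have indM : {in induced &, forall a b, a * b \in induced}.
  move=> a b /asboolP[T [h [h1 [h2 ha]]]] /asboolP[U [k [k1 [k2 kb]]]].
  apply/asboolP; have [V [V1 V2]] := deck_comp_ex T U.
  have l1 : is_path p0 (h ++ map (dseg T) k).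
    by rewrite is_path_cat h1 h2 deck_path.
  have l2 : endpoint p0 (h ++ map (dseg T) k) = dpoint V p0.
    by rewrite endpoint_cat h2 deck_endpoint k2 V1.
  exists V, _, l1, l2 => w; rewrite /= kb ha; congr loop_class; apply: val_inj.
  rewrite /= !map_cat deck_pathV (eq_map V2) map_comp -!catA.
  by rewrite [in RHS]/pathV map_cat rev_cat.
have indV : {in induced, forall a, a^-1 \in induced}.
  move=> a /asboolP[T [h [h1 [h2 ha]]]]; apply/asboolP.
  have [V [V1 V2 V3 V4]] := deck_inv_ex T.
  have /andP[v1 /eqP v2] := is_pathV h1; rewrite h2 in v1 v2.
  have l1 : is_path p0 (map (dseg V) (pathV h)).
    by rewrite -[X in is_path X _]V1 deck_path.
  have l2 : endpoint p0 (map (dseg V) (pathV h)) = dpoint V p0.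
    by rewrite -[X in endpoint X _]V1 deck_endpoint v2.
  exists V, _, l1, l2 => w.
  apply: (can_inj (autK_inv a)); rewrite aut_invK ha; symmetry.
  have TV u : map (dseg T) (map (dseg V) u) = u.
    by rewrite -map_comp -[RHS]map_id; apply: eq_map.
  pose c : loop p0 := conj_loop h1 h2 (conj_loop l1 l2 w).
  have cE : val c = h ++ pathV h ++ val w ++ h ++ pathV h.
    by rewrite /= !map_cat !TV deck_pathV TV pathVK -!catA.
  have hh : is_closed p0 (h ++ pathV h).
    by rewrite /is_closed is_path_cat endpoint_cat h1 h2 v1 v2 /=.
  pose d : loop p0 := Sub _ hh.
  have d1 : loop_class d = 1 by apply/gclassP; exact: (homotopic_spur h1).
  rewrite -/c; have -> : c = loop_cat (loop_cat d w) d.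
    by apply: val_inj; rewrite cE /= -!catA.
  rewrite -[LHS]/(loop_class (loop_cat (loop_cat d w) d)).
  have M (x y : loop p0) :
      loop_class (loop_cat x y) = loop_class x * loop_class y.
    by rewrite /loop_class -[RHS]/(quot_mul _ _) quot_mulE.
  by rewrite !M d1 mul1g mulg1.
split=> // a b ha hb; exact/indM/indV.
Qed.

Definition inducedAut : Type := {a : automorphism (pi1 p0) | a \in induced}.
HB.instance Definition _ := SubChoice.on inducedAut.
HB.instance Definition _ := SubChoice_isSubGroup.Build
  (automorphism (pi1 p0)) (fun a => a \in induced) inducedAut
  induced_group_closed.
End InducedAutomorphisms.

Section PrincipalGroup.
Variables (K M : lineComplex) (B : lineCovering K M).
Variables (I : countType) (gen : I -> segment M).

Definition letter_seg (x : letter I) : segment M :=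
  if x.2 then sinv (gen x.1) else gen x.1.

(* The segments of M are gen i and sinv (gen i), without repetition. *)
Definition enumerates_segments : Prop := bijective letter_seg.

Definition closed_word (W : seq (letter I)) : Prop :=
  forall p u, is_path p u -> map (cseg B) u = map letter_seg W ->
    is_closed p u.

Definition closed_words (x : freeGroup I) : Prop :=
  exists W, x = word_class W /\ closed_word W.

Lemma word_classM (W X : seq (letter I)) :
  word_class (W ++ X) = word_class W * word_class X.
Proof. by rewrite -[RHS]/(quot_mul _ _) quot_mulE. Qed.

Lemma word_classV (W : seq (letter I)) :
  word_class (wordV W) = (word_class W)^-1.
Proof.
by apply: (mulIg (word_class W)); rewrite mulVg -word_classM;
   apply/gclassP/(gs_mulVx (g := freeSetoid I)).
Qed.

Lemma letter_segV x : letter_seg (letterV x) = sinv (letter_seg x).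
Proof. by case: x => i []; rewrite /letter_seg //= sinvK. Qed.

Lemma word_pathV W : map letter_seg (wordV W) = pathV (map letter_seg W).
Proof.
rewrite /wordV /pathV map_rev -!map_comp; congr rev.
by apply: eq_map => x /=; rewrite letter_segV.
Qed.

Lemma cseg_pathV u : map (cseg B) (pathV u) = pathV (map (cseg B) u).
Proof.
rewrite /pathV map_rev -!map_comp; congr rev.
by apply: eq_map => s /=; rewrite cseg_sinv.
Qed.

Lemma path_lift_unique p u v : is_path p u -> is_path p v ->
  map (cseg B) u = map (cseg B) v -> u = v.
Proof.
elim: u p v => [|s u IH] p [|t v] //= /andP[/eqP s1 u1] /andP[/eqP t1 v1].
move=> [st uv]; have ts : initial (cseg B s) = cpoint B p.
  by rewrite cseg_initial s1.
have [r [_ r2]] := cseg_star ts.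
have e : s = t by rewrite -(r2 s) // -(r2 t).
by rewrite -{}e in v1 *; rewrite (IH _ _ u1 v1 uv).
Qed.

Let map_split (A T : Type) (f : A -> T) u X Y : map f u = X ++ Y ->
  exists u1 u2, [/\ u = u1 ++ u2, map f u1 = X & map f u2 = Y].
Proof.
move=> h; exists (take (size X) u), (drop (size X) u).
by rewrite cat_take_drop map_take map_drop h take_size_cat // drop_size_cat.
Qed.

Let closed_words1 : closed_words 1.
Proof.
by exists [::]; split=> // p [|s u] //= _ _; rewrite /is_closed /= eqxx.
Qed.

Let closed_wordsM x y :
  closed_words x -> closed_words y -> closed_words (x * y).
Proof.
move=> [W [-> hW]] [X [-> hX]]; exists (W ++ X); rewrite word_classM.
split=> // p u hu; rewrite map_cat => /map_split[u1 [u2 [def_u e1 e2]]].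
move: hu; rewrite {}def_u /is_closed is_path_cat endpoint_cat => /andP[h1 h2].
have /andP[_ /eqP c1] := hW _ _ h1 e1; rewrite c1 in h2 *.
by have /andP[_ c2] := hX _ _ h2 e2; rewrite h1 h2.
Qed.

Let closed_wordsV x : closed_words x -> closed_words x^-1.
Proof.
move=> [W [-> hW]]; exists (wordV W); rewrite word_classV.
split=> // p u hu; rewrite word_pathV => e.
have /andP[v1 /eqP v2] := is_pathV hu.
have : map (cseg B) (pathV u) = map letter_seg W by rewrite cseg_pathV e pathVK.
move=> /(hW _ _ v1) /andP[_ /eqP v3].
by rewrite /is_closed hu /= -v3 v2.
Qed.

Let closed_wordsJ x y : closed_words x -> closed_words (y * x * y^-1).
Proof.
move=> [W [-> hW]]; have [X ->] : exists X, y = word_class X.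
  by exists (@grepr (freeSetoid I) y); rewrite /word_class greprK.
exists (X ++ W ++ wordV X); rewrite !word_classM word_classV mulgA.
split=> // p u hu; rewrite !map_cat word_pathV.
move=> /map_split[u1 [u' [def_u e1 /map_split[u2 [u3 [def_u' e2 e3]]]]]].
move: hu; rewrite {}def_u {}def_u' /is_closed !is_path_cat !endpoint_cat.
move=> /and3P[h1 h2 h3].
have /andP[_ /eqP c2] := hW _ _ h2 e2; rewrite c2 in h3 *.
have /andP[v1 v2] := is_pathV h1.
have -> : u3 = pathV u1.
  by apply: path_lift_unique h3 v1 _; rewrite cseg_pathV e1.
by rewrite h1 h2 v1 v2.
Qed.

Definition closed_words_normal : normalSubgroup (freeGroup I) :=
  NormalSubgroup closed_words1 closed_wordsM closed_wordsV closed_wordsJ.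

Definition principalGroup : groupType := factorGroup closed_words_normal.

Definition principal_class (W : seq (letter I)) : principalGroup :=
  fclass closed_words_normal (word_class W).
End PrincipalGroup.

(* The subgroup of the principal group of A o A' given by the words under the
   paths of K whose end points lie over p0; it is isomorphic to pi1 p0. *)
Definition covering_subgroup (K C M : lineComplex) (A : lineCovering C M)
    (A' : lineCovering K C) (p0 : pt C) (I : countType)
    (gen : I -> segment M) : set (principalGroup (comp_cov A A') gen) :=
  [set v | exists p w W,
     [/\ is_path p w, cpoint A' p = p0, cpoint A' (endpoint p w) = p0,
         map (letter_seg gen) W = map (cseg (comp_cov A A')) w
       & v = principal_class (comp_cov A A') gen W] ].

Arguments covering_subgroup {K C M} A A' p0 {I} gen _.

(* Main.v *)
Require Import Defs.
From HB Require Import structures.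
From Stdlib Require Import Relation_Operators.
From mathcomp Require Import all_boot.
From mathcomp Require Import boolp classical_sets.

Set Implicit Arguments.
Unset Strict Implicit.
Unset Printing Implicit Defensive.

Local Open Scope group_scope.

(** A word [W] in the generators is a path in the one-point complex [Cs].  For a
    loop [w] of [C] at [p0], lift the path [W A(w) W^-1] to [C] at [p0]: the
    lift of [W] ends at some point [T p0] with [T] a deck transformation
    ([deck_ex], by regularity), so the whole lift is [h T(w) h^-1] with [h] over
    [W].  Hence conjugation by [W], read downstairs, is upstairs the
    automorphism that [T] induces along [h].  The relation [realizes W a] says
    that the automorphism [a] of the fundamental group arises from [W] in this
    way.  Each word realizes an induced automorphism ([realizes_induced]), each
    induced automorphism is realized by the word under its path [h]
    ([induced_realizes]), and [realizes] is multiplicative ([realizesM]).  That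
    [w |-> h T(w) h^-1] respects homotopy is part of the assumption that [T],
    when not the identity, induces some automorphism; a change of [h] composes
    it with an inner one ([induces_path]).

    It remains to see that words realizing the identity are exactly the words
    whose lifts to [K] are all closed.  The latter holds iff the lift [h] of [W]
    at [p0] is closed and null-homotopic ([closed_word_null]): deck
    transformations carry it to the lifts at the other points, and a path of [K]
    is closed iff its image in [C] is closed and null-homotopic.  If [h] is
    null-homotopic, then [W] realizes the identity ([realizes_closed]).
    Conversely, if [W] realizes the identity, then its deck transformation
    induces an inner automorphism, hence is the identity, so [h] is a loop; its
    class commutes with all classes of loops, so the element of the principal
    group given by [W] lies in the centre of the subgroup belonging to the
    covering, and is therefore trivial ([closed_word_of_realizes1]).  So
    [realizes] descends to a multiplicative one-to-one correspondence between
    the two groups. *)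

(** * Lifting paths *)

Section Lifting.
Variables (L M : lineComplex) (A : lineCovering L M).

Lemma cseg_final s : final (cseg A s) = cpoint A (final s).
Proof. by rewrite -initial_sinv -cseg_sinv cseg_initial initial_sinv. Qed.

Lemma cseg_inj s s' : initial s = initial s' -> cseg A s = cseg A s' -> s = s'.
Proof.
move=> i c; have [r [_ r_uniq]] := cseg_star (cseg_initial A s).
by rewrite -(r_uniq s) // -(r_uniq s').
Qed.

Lemma image_path p u :
  is_path p u -> is_path (cpoint A p) (map (cseg A) u).
Proof.
elim: u p => //= s u IH p /andP[/eqP <- /IH].
by rewrite cseg_initial cseg_final eqxx.
Qed.

Lemma image_endpoint p u :
  endpoint (cpoint A p) (map (cseg A) u) = cpoint A (endpoint p u).
Proof.
by elim: u p => //= s u IH p; rewrite /endpoint /= cseg_final; exact: IH.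
Qed.

Lemma path_lift_ex p w : is_path (cpoint A p) w ->
  exists u, is_path p u /\ map (cseg A) u = w.
Proof.
elim: w p => [|t w IH] p /=; first by exists [::].
move=> /andP[/eqP tp]; have [s [[sp <-] _]] := cseg_star tp.
rewrite cseg_final => /IH[u [hu <-]].
by exists (s :: u); rewrite /= sp eqxx.
Qed.

End Lifting.

Lemma path_rev (L : lineComplex) (p : pt L) w : is_path p w ->
  is_path (endpoint p w) (pathV w) /\ endpoint (endpoint p w) (pathV w) = p.
Proof. by move=> /is_pathV /andP[? /eqP]. Qed.

Lemma pathV_cat (L : lineComplex) (u v : seq (segment L)) :
  pathV (u ++ v) = pathV v ++ pathV u.
Proof. by rewrite /pathV map_cat rev_cat. Qed.

(** * Deck transformations of a regular covering *)

Section Translations.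
Variables (L M : lineComplex) (A : lineCovering L M).
Hypothesis L_connected : connected L.

(** A deck transformation without bijectivity, which for a regular connected
    covering follows from rigidity. *)
Definition over_map (t : pt L -> pt L) (g : segment L -> segment L) : Prop :=
  [/\ forall s, initial (g s) = t (initial s),
      forall s, g (sinv s) = sinv (g s),
      forall x, cpoint A (t x) = cpoint A x &
      forall s, cseg A (g s) = cseg A s].

Lemma over_map_comp t g t' g' :
  over_map t g -> over_map t' g' -> over_map (t \o t') (g \o g').
Proof.
move=> [i v p s] [i' v' p' s']; split=> x /=.
- by rewrite i i'.
- by rewrite v' v.
- by rewrite p p'.
- by rewrite s s'.
Qed.

(** A fixed point forces the segments that begin at it to be fixed, since the
    covering is injective on them; hence their end points are fixed, and
    fixedness spreads along paths to the whole complex. *)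
Lemma over_map_rigid t g p :
  over_map t g -> t p = p -> t =1 id /\ g =1 id.
Proof.
move=> [i v _ c] tp.
have fix_seg s : t (initial s) = initial s -> g s = s.
  by move=> e; apply: (@cseg_inj _ _ A); rewrite ?i.
have fix_end w q : t q = q -> is_path q w -> t (endpoint q w) = endpoint q w.
  elim: w q => // s w IH q tq /= /andP[/eqP sq].
  have gs : g s = s by apply: fix_seg; rewrite sq.
  by apply: IH; rewrite -initial_sinv -i v gs.
have t1 : t =1 id.
  by move=> x; have [w [hw <-]] := L_connected p x; exact: fix_end.
by split=> // s; apply: fix_seg; rewrite t1.
Qed.

Lemma deck_rigid (T : deck A) p : dpoint T p = p -> is_identity T.
Proof.
apply: over_map_rigid; split; first exact: dseg_initial.
- exact: dseg_sinv.
- exact: dpoint_over.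
- exact: dseg_over.
Qed.

Hypothesis A_regular : regular A.

Let corresponds p q x y : Prop := exists w u,
  [/\ is_path p w, is_path q u, endpoint p w = x, endpoint q u = y
    & map (cseg A) w = map (cseg A) u].

(** This is where regularity enters: two paths from [p] to [x] form a closed
    path, so their translates to [q] form one as well. *)
Let corresponds_uniq p q x y y' : cpoint A p = cpoint A q ->
  corresponds p q x y -> corresponds p q x y' -> y = y'.
Proof.
move=> pq [w [u [hw hu wx uy wu]]] [w' [u' [hw' hu' wx' uy' wu']]].
have [hV eV] := path_rev hw'.
have [v [hv vw]] : exists v, is_path y v /\
    map (cseg A) v = map (cseg A) (pathV w').
  apply: path_lift_ex.
  rewrite -uy -image_endpoint -pq -wu image_endpoint wx -wx'.
  exact: image_path.
have closed_ww : is_closed p (w ++ pathV w').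
  by rewrite /is_closed is_path_cat endpoint_cat hw wx -wx' hV eV /=.
have /andP[_ /eqP] : is_closed q (u ++ v).
  apply: (A_regular _ _ pq _ closed_ww); first by case/andP: closed_ww.
    by rewrite is_path_cat hu uy.
  by rewrite !map_cat wu vw.
rewrite endpoint_cat uy => yq; have [hv' ev'] := path_rev hv.
rewrite -uy' -ev' yq; congr endpoint; rewrite yq in hv'.
apply: (@path_lift_unique _ _ A _ _ _ hv' hu').
by rewrite cseg_pathV vw cseg_pathV pathVK.
Qed.

(** The point [x] is sent to the end of the translate to [q] of any path from
    [p] to [x]. *)
Lemma over_map_ex p q : cpoint A p = cpoint A q ->
  exists t g, over_map t g /\ t p = q.
Proof.
move=> pq.
have [t tP] : {t : pt L -> pt L & forall x, corresponds p q x (t x)}.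
  apply: (choice (P := fun x => corresponds p q x)) => x.
  have [w [hw wx]] := L_connected p x.
  have [u [hu uw]] : exists u, is_path q u /\ map (cseg A) u = map (cseg A) w.
    by apply: path_lift_ex; rewrite -pq; exact: image_path.
  by exists (endpoint q u), w, u.
have t_over x : cpoint A (t x) = cpoint A x.
  have [w [u [_ _ <- <- wu]]] := tP x.
  by rewrite -!image_endpoint pq wu.
have [g gP] : {g : segment L -> segment L &
    forall s, initial (g s) = t (initial s) /\ cseg A (g s) = cseg A s}.
  apply: (choice (P := fun s s' => initial s' = t (initial s) /\
    cseg A s' = cseg A s)) => s.
  have : initial (cseg A s) = cpoint A (t (initial s)).
    by rewrite t_over cseg_initial.
  by move=> /cseg_star[s' [? _]]; exists s'.
have g_final s : final (g s) = t (final s).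
  suff h : corresponds p q (final s) (final (g s)).
    exact: corresponds_uniq pq h (tP _).
  have [w [u [hw hu wx ux wu]]] := tP (initial s).
  have [gi gc] := gP s.
  exists (rcons w s), (rcons u (g s)).
  rewrite -!cats1 !is_path_cat !endpoint_cat.
  by rewrite hw hu wx ux !map_cat wu /endpoint /= gc gi !eqxx.
exists t, g; split; last first.
  suff h : corresponds p q p q by exact: corresponds_uniq pq (tP p) h.
  by exists [::], [::].
split=> // s; [by case: (gP s) | | by case: (gP s)].
have [gi gc] := gP (sinv s); apply: (@cseg_inj _ _ A).
  by rewrite gi !initial_sinv g_final.
by rewrite gc !cseg_sinv; case: (gP s) => _ ->.
Qed.

(** The maps carrying [p] to [q] and [q] to [p] are mutually inverse, because
    their composites have a fixed point. *)
Lemma deck_ex p q : cpoint A p = cpoint A q ->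
  exists T : deck A, dpoint T p = q.
Proof.
move=> pq; have [t [g [h tp]]] := over_map_ex pq.
have [t' [g' [h' tq]]] := over_map_ex (esym pq).
have [e1 e2] : cancel t t' /\ cancel g g'.
  apply: (@over_map_rigid (t' \o t) (g' \o g) p); first exact: over_map_comp.
  by rewrite /= tp.
have [e3 e4] : cancel t' t /\ cancel g' g.
  apply: (@over_map_rigid (t \o t') (g \o g') q); first exact: over_map_comp.
  by rewrite /= tq.
case: h => i v c s.
by exists (@Deck _ _ A t g (Bijective e1 e3) (Bijective e2 e4) i v c s).
Qed.

End Translations.

(** * Homotopy and change of base point *)

Section Loops.
Variable C : surfaceComplex.
Implicit Types p q : pt C.

Lemma loop_classM p (x y : loop p) :
  loop_class (loop_cat x y) = loop_class x * loop_class y.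
Proof. by rewrite /loop_class -[RHS]/(quot_mul _ _) quot_mulE. Qed.

Lemma loop_class_spur p w (c : loop p) :
  is_path p w -> val c = w ++ pathV w -> loop_class c = 1.
Proof. by move=> hw hc; apply/gclassP/(homotopic_spur hw hc). Qed.

Lemma loop_class_inv p (x : loop p) :
  loop_class (loop_inv x) = (loop_class x)^-1.
Proof.
apply: (mulgI (loop_class x)); rewrite mulgV -loop_classM.
by apply: (@loop_class_spur _ (val x)) => //; case/andP: (valP x).
Qed.

Definition null p w : Prop :=
  exists c : loop p, val c = w /\ loop_class c = 1.

Lemma closed_conj q g w :
  is_path q g -> is_closed (endpoint q g) w -> is_closed q (g ++ w ++ pathV g).
Proof.
move=> hg /andP[hw /eqP ew]; have [hV eV] := path_rev hg.
by rewrite /is_closed !is_path_cat !endpoint_cat hg hw ew hV eV /=.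
Qed.

Lemma conj_closed q g w :
  is_closed q (g ++ w ++ pathV g) -> is_closed (endpoint q g) w.
Proof.
rewrite /is_closed !is_path_cat !endpoint_cat => /andP[/and3P[hg hw hV] /eqP e].
have [_] := path_rev hV; rewrite e pathVK hw => e'; exact/eqP/esym.
Qed.

(** A deletion inside [a] is also a deletion inside [g a g^-1].  The equations
    for [a'] and [b'] stand in for a conjugation function on loops, so that the
    end of [g] need only be provably equal to [p]. *)
Lemma loop_class_conj q p g (a b : loop p) (a' b' : loop q) :
  is_path q g -> endpoint q g = p -> loop_class a = loop_class b ->
  val a' = g ++ val a ++ pathV g -> val b' = g ++ val b ++ pathV g ->
  loop_class a' = loop_class b'.
Proof.
move=> hg gp; move: a b; case: _ / gp => a b.
pose conj (x : loop (endpoint q g)) : loop q :=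
  Sub _ (closed_conj hg (valP x)).
move=> /gclassP ab a'E b'E.
have -> : a' = conj a by exact: val_inj.
have -> : b' = conj b by exact: val_inj.
apply/gclassP; elim: ab {a'E b'E} => [x y xy|x|x y _ h|x y z _ h1 _ h2].
- apply: rst_step => /=; case: xy => [u s v|u f r w v h];
    rewrite -!catA !(catA g).
    exact: DeleteSpur.
  exact: DeleteBoundary h.
- exact: rst_refl.
- exact: rst_sym.
- exact: rst_trans h1 h2.
Qed.

(** Conjugating [h w h^-1] back along [h^-1] gives [d w d] with [d = h^-1 h],
    whose class is trivial. *)
Lemma null_conj p h w :
  null p (h ++ w ++ pathV h) -> null (endpoint p h) w.
Proof.
move=> [c [cE c1]].
have hc : is_closed p (h ++ w ++ pathV h) by rewrite -cE; exact: valP.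
have hh : is_path p h by case/andP: hc; rewrite is_path_cat => /andP[].
have [hV eV] := path_rev hh.
exists (Sub _ (conj_closed hc)); split=> //; set b : loop _ := Sub w _.
have d_closed : is_closed (endpoint p h) (pathV h ++ h).
  by rewrite -[X in _ ++ X]pathVK (@closed_conj _ _ [::]) // eV /is_closed eqxx.
pose d : loop (endpoint p h) := Sub _ d_closed.
have d1 : loop_class d = 1 by apply: (loop_class_spur hV); rewrite pathVK.
rewrite -d1 -[LHS]mul1g -[LHS]mulg1 -d1 -(loop_classM d b) -loop_classM.
apply: (loop_class_conj (a := c) (b := loop_nil p) hV eV) => //=.
  by rewrite cE pathVK -!catA.
by rewrite pathVK.
Qed.
End Loops.

(** * Groups and correspondences *)

Section Automorphisms.
Variable G : groupType.

Lemma aut_one_val (a : automorphism G) : a 1 = 1.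
Proof. by apply: (mulgI (a 1)); rewrite -aut_morph !mulg1. Qed.

Let conj_bij (g : G) : bijective (fun x => g * x * g^-1).
Proof.
exists (fun x => g^-1 * x * g) => x; first by rewrite !mulgA mulVg mul1g mulgVK.
by rewrite !mulgA mulgV mul1g mulgK.
Qed.

Let conj_morph (g : G) : {morph (fun x => g * x * g^-1) : x y / x * y}.
Proof. by move=> x y; rewrite !mulgA mulgVK. Qed.

Definition inner_aut (g : G) : automorphism G :=
  Automorphism (conj_bij g) (@conj_morph g).

End Automorphisms.

(** Neither direction of the correspondence between words and automorphisms is
    given by a function before choices are made; a relation avoids making them
    early. *)
Lemma isomorphic_of_rel (G H : groupType) (R : G -> H -> Prop) :
  (forall x, exists y, R x y) -> (forall y, exists x, R x y) ->
  (forall x y x' y', R x y -> R x' y' -> x = x' <-> y = y') ->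
  (forall x y x' y', R x y -> R x' y' -> R (x * x') (y * y')) ->
  isomorphic G H.
Proof.
move=> Rl Rr R_eq RM.
have [f fP] := choice Rl; have [g gP] := choice Rr.
exists f; split.
  exists g => [x | y].
    exact/(R_eq _ _ _ _ (gP (f x)) (fP x)).
  exact/(R_eq _ _ _ _ (fP (g y)) (gP y)).
by move=> x y; apply/(R_eq _ _ _ _ (fP (x * y)) (RM _ _ _ _ (fP x) (fP y))).
Qed.

(** * Words over a one-point complex and the principal group *)

Section Words.
Variables (K M : lineComplex) (B : lineCovering K M).
Variables (I : countType) (gen : I -> segment M).
Hypothesis M_point : forall q q' : pt M, q = q'.
Local Notation sg := (map (letter_seg gen)).

Lemma one_point_path q (w : seq (segment M)) : is_path q w.
Proof.
by elim: w q => //= s w IH q; rewrite IH (M_point (initial s) q) eqxx.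
Qed.

Lemma one_point_lift p (w : seq (segment M)) :
  exists u, is_path p u /\ map (cseg B) u = w.
Proof. exact/path_lift_ex/one_point_path. Qed.

Lemma closed_wordP W :
  closed_word B gen W <->
  forall p, exists u, is_closed p u /\ map (cseg B) u = sg W.
Proof.
split=> [h p | h p u hu uW].
  have [u [hu uW]] := one_point_lift p (sg W).
  by exists u; split=> //; exact: h uW.
have [v [hv vW]] := h p; have /andP[pv _] := hv.
suff -> : u = v by [].
by apply: (@path_lift_unique _ _ B _ _ _ hu pv); rewrite uW vW.
Qed.

(** The lift of a cancelling pair [x x^-1] is a spur [s s^-1], so inserting it
    does not move the end point of a lift. *)
Lemma cancel_closed W W' :
  cancel_word W W' -> closed_word B gen W <-> closed_word B gen W'.
Proof.
case=> u x v.
have lift p : exists a b, [/\ is_closed p a = is_closed p b,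
    is_path p a, is_path p b,
    map (cseg B) a = sg (u ++ [:: x; letterV x] ++ v) &
    map (cseg B) b = sg (u ++ v)].
  have [u' [hu uE]] := one_point_lift p (sg u).
  have [v' [hv vE]] := one_point_lift (endpoint p u') (sg v).
  have [s [[si sx] _]] : exists! s, initial s = endpoint p u' /\
    cseg B s = letter_seg gen x by apply: cseg_star; exact: M_point.
  have [fs iS] : final (sinv s) = endpoint p u' /\ initial (sinv s) = final s.
    by rewrite final_sinv initial_sinv.
  exists (u' ++ [:: s; sinv s] ++ v'), (u' ++ v').
  rewrite /is_closed !is_path_cat !endpoint_cat /= /endpoint /=.
  rewrite -/(endpoint p u') fs iS si !eqxx /= hu hv !map_cat /= uE vE.
  by rewrite cseg_sinv sx letter_segV.
split=> /closed_wordP h; apply/closed_wordP => p; have [w [hw wE]] := h p;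
  have [a [b [ab pa pb aE bE]]] := lift p; have /andP[pw _] := hw.
  exists b; split=> //; rewrite -ab -(_ : w = a) //.
  by apply: (@path_lift_unique _ _ B _ _ _ pw pa); rewrite wE.
exists a; split=> //; rewrite ab -(_ : w = b) //.
by apply: (@path_lift_unique _ _ B _ _ _ pw pb); rewrite wE.
Qed.

Lemma closed_word_class W W' : word_class W = word_class W' ->
  closed_word B gen W <-> closed_word B gen W'.
Proof.
move=> /gclassP; elim=> [x y|x|x y _ h|x y z _ h1 _ h2] //.
- exact: cancel_closed.
- by split=> /h.
- by split=> [/h1/h2 | /h2/h1].
Qed.

Lemma principal_classP W X :
  principal_class B gen W = principal_class B gen X <->
  closed_word B gen (W ++ wordV X).
Proof.
rewrite /principal_class /fclass; split=> [/gclassP [Y [YE hY]] | h].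
  apply/(closed_word_class (W := Y)) => //.
  by rewrite -YE word_classM word_classV.
by apply/gclassP; exists (W ++ wordV X); rewrite word_classM word_classV.
Qed.

Lemma principal_classM W X :
  principal_class B gen (W ++ X) =
  principal_class B gen W * principal_class B gen X.
Proof.
by rewrite -[RHS]/(quot_mul _ _) quot_mulE /principal_class word_classM.
Qed.

Lemma principal_class1 W :
  principal_class B gen W = 1 <-> closed_word B gen W.
Proof.
rewrite -[X in _ <-> closed_word _ _ X]cats0.
exact: (principal_classP W [::]).
Qed.

Lemma principal_class_surj (v : principalGroup B gen) :
  exists W, v = principal_class B gen W.
Proof.
rewrite -(greprK v); set x := grepr v; exists (@grepr (freeSetoid I) x).
by rewrite /principal_class /word_class greprK.
Qed.

Lemma word_of_path : enumerates_segments gen ->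
  forall w : seq (segment M), exists W, sg W = w.
Proof.
move=> [f _ fK] w; exists (map f w); rewrite -map_comp -[RHS]map_id.
by apply: eq_map.
Qed.

End Words.

(** * Automorphisms induced by a deck transformation *)

Section InducedAutomorphisms.
Variables (C Cs : surfaceComplex) (A : covering C Cs) (p0 : pt C).

(** If [T] induces [a] along [k], then [h T(w) h^-1] is homotopic to the
    conjugate of [k T(w) k^-1] by the loop [h k^-1].  In particular
    [w |-> h T(w) h^-1] is well defined on classes for every [h] as soon as it
    is for one. *)
Lemma induces_path (T : deck A) (a : automorphism (pi1 p0)) h
    (h1 : is_path p0 h) (h2 : endpoint p0 h = dpoint T p0) : induces T a ->
  exists a' : automorphism (pi1 p0),
    (forall w, a' (loop_class w) = loop_class (conj_loop h1 h2 w)) /\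
    exists g, forall x, a' x = g * a x * g^-1.
Proof.
move=> [k [k1 [k2 ka]]].
have [hV eV] := path_rev h1; have [kV ekV] := path_rev k1.
rewrite h2 in hV eV; rewrite k2 in kV ekV.
have g_closed : is_closed p0 (h ++ pathV k).
  by rewrite /is_closed is_path_cat endpoint_cat h1 h2 kV ekV /=.
pose g : loop p0 := Sub _ g_closed.
exists (inner_aut (loop_class g) * a); split; last by exists (loop_class g).
move=> w; rewrite -[LHS]/(loop_class g * a (loop_class w) * (loop_class g)^-1).
rewrite ka -loop_class_inv -loop_classM -loop_classM.
have d_closed : is_closed (dpoint T p0) (pathV k ++ k).
  by rewrite /is_closed is_path_cat endpoint_cat kV ekV k1 k2 /=.
have w_closed : is_closed (dpoint T p0) (map (dseg T) (val w)).
  have /andP[w1 /eqP w2] := valP w.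
  by rewrite /is_closed deck_path // deck_endpoint w2 eqxx.
pose d : loop (dpoint T p0) := Sub _ d_closed.
pose Tw : loop (dpoint T p0) := Sub _ w_closed.
have d1 : loop_class d = 1 by apply: (loop_class_spur kV); rewrite pathVK.
have dTw : loop_class (loop_cat (loop_cat d Tw) d) = loop_class Tw.
  by rewrite !loop_classM d1 mul1g mulg1.
by apply: (loop_class_conj h1 h2 dTw); rewrite //= pathV_cat pathVK -!catA.
Qed.

Lemma induces_inner (T : deck A) (a b : automorphism (pi1 p0)) :
  induces T a -> induces T b -> inner a -> inner b.
Proof.
move=> Ta [k [k1 [k2 kb]]] [c ac].
have [a' [a'E [g a'g]]] := induces_path k1 k2 Ta.
exists (g * c) => x; have [w ->] := loop_class_surj x.
by rewrite kb -a'E a'g ac invgM !mulgA.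
Qed.

Lemma induces_identity (T : deck A) :
  is_identity T -> @induces _ _ _ p0 T 1.
Proof.
move=> [T1 T2]; exists [::], isT, (esym (T1 p0)) => w.
by congr loop_class; apply: val_inj; rewrite /= cats0 (eq_map T2) map_id.
Qed.

(** A deck transformation is a map of lines only; that it preserves homotopy is
    contained in its inducing an automorphism along some path [k]: the trivial
    class goes to the class of [k T(w) k^-1]. *)
Lemma deck_null (T : deck A) (a : automorphism (pi1 p0)) w :
  induces T a -> null p0 w -> null (dpoint T p0) (map (dseg T) w).
Proof.
move=> [k [k1 [k2 ka]]] [c [<- c1]]; rewrite -k2; apply: null_conj.
by exists (conj_loop k1 k2 c); split=> //; rewrite -ka c1 aut_one_val.
Qed.

End InducedAutomorphisms.

(** * Conjugation by words *)

Section Realization.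
Variables (C Cs : surfaceComplex) (A : covering C Cs) (p0 : pt C).
Hypothesis C_connected : connected C.
Hypothesis Cs_point : forall q q' : pt Cs, q = q'.
Hypothesis A_regular : regular A.
Variables (K : surfaceComplex) (A' : covering K C).
Hypothesis A'_universal : universal_covering A'.
Variables (I : countType) (gen : I -> segment Cs).
Hypothesis gen_enum : enumerates_segments gen.
Hypothesis all_induce :
  forall T : deck A, exists a : automorphism (pi1 p0), induces T a.

Local Notation B := (comp_cov A A').
Local Notation sg := (map (letter_seg gen)).

Lemma closed_iff_null p u :
  is_path p u -> is_closed p u <-> null (cpoint A' p) (map (cseg A') u).
Proof. by case: A'_universal => _ _; exact. Qed.

Lemma map_comp_cov (u : seq (segment K)) :
  map (cseg B) u = map (cseg A) (map (cseg A') u).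
Proof. by rewrite -map_comp. Qed.

(** A word is closed when its lifts at all points of [K] are closed.  Seen from
    [C], these are null-homotopy conditions on the lifts at all points, and deck
    transformations reduce them to the one at [p0]. *)
Lemma closed_word_null W h : is_path p0 h -> map (cseg A) h = sg W ->
  closed_word B gen W <-> null p0 h.
Proof.
move=> hp hW; split=> [hc | hn p u pu uW].
  have [k k0] := cpoint_surj A' p0; rewrite -k0 in hp *.
  have [u [pu uh]] := path_lift_ex hp.
  rewrite -uh; apply/(closed_iff_null pu)/hc => //.
  by rewrite map_comp_cov uh.
have [T Tp] := deck_ex C_connected A_regular
  (Cs_point (cpoint A p0) (cpoint A (cpoint A' p))).
have [a aT] := all_induce T.
apply/(closed_iff_null pu); rewrite -(_ : map (dseg T) h = map (cseg A') u).
  by rewrite -Tp; exact: deck_null aT hn.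
have Tpath := deck_path T hp; rewrite Tp in Tpath.
apply: (@path_lift_unique _ _ A _ _ _ Tpath (image_path A' pu)).
rewrite -map_comp_cov uW -hW -map_comp; apply: eq_map => s /=.
exact: dseg_over.
Qed.

(** Stated through the image in [Cs], so that products of words need no
    bookkeeping of deck transformations; [realizesP] gives the form
    [a [w] = [h T(w) h^-1] ]. *)
Definition realizes (W : seq (letter I)) (a : automorphism (pi1 p0)) : Prop :=
  forall w c : loop p0,
    map (cseg A) (val c) = sg W ++ map (cseg A) (val w) ++ pathV (sg W) ->
    a (loop_class w) = loop_class c.

Lemma image_conj_loop (T : deck A) h (h1 : is_path p0 h)
    (h2 : endpoint p0 h = dpoint T p0) (w : loop p0) W :
  map (cseg A) h = sg W ->
  map (cseg A) (val (conj_loop h1 h2 w)) =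
  sg W ++ map (cseg A) (val w) ++ pathV (sg W).
Proof.
move=> hW; rewrite /= !map_cat cseg_pathV hW -map_comp.
by congr (_ ++ (_ ++ _)); apply: eq_map => s /=; exact: dseg_over.
Qed.

Lemma loop_image_inj (c d : loop p0) :
  map (cseg A) (val c) = map (cseg A) (val d) -> c = d.
Proof.
have /andP[pc _] := valP c; have /andP[pd _] := valP d.
by move=> cd; apply/val_inj/(path_lift_unique pc pd cd).
Qed.

Lemma realizesP (T : deck A) h (h1 : is_path p0 h)
    (h2 : endpoint p0 h = dpoint T p0) a W :
  map (cseg A) h = sg W ->
  realizes W a <->
  forall w, a (loop_class w) = loop_class (conj_loop h1 h2 w).
Proof.
move=> hW; split=> [r w | r w c cE]; first exact/r/image_conj_loop.
rewrite r; congr loop_class; apply: loop_image_inj.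
by rewrite cE; exact: image_conj_loop.
Qed.

Lemma word_deck W : exists h (T : deck A),
  [/\ is_path p0 h, endpoint p0 h = dpoint T p0 & map (cseg A) h = sg W].
Proof.
have [h [hp hW]] := one_point_lift A Cs_point p0 (sg W).
have [T Tp] := deck_ex C_connected A_regular
  (Cs_point (cpoint A p0) (cpoint A (endpoint p0 h))).
by exists h, T.
Qed.

Lemma conj_lift W (w : loop p0) : exists c : loop p0,
  map (cseg A) (val c) = sg W ++ map (cseg A) (val w) ++ pathV (sg W).
Proof.
have [h [T [h1 h2 hW]]] := word_deck W.
by exists (conj_loop h1 h2 w); exact: image_conj_loop.
Qed.

Lemma realizes_induced W : exists a : inducedAut A p0, realizes W (val a).
Proof.
have [h [T [h1 h2 hW]]] := word_deck W.
have [b bT] := all_induce T; have [a [aE _]] := induces_path h1 h2 bT.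
have a_ind : a \in @induced _ _ A p0.
  by apply/asboolP; exists T, h, h1, h2.
by exists (Sub a a_ind); rewrite /=; apply/(realizesP h1 h2 _ hW).
Qed.

Lemma induced_realizes (a : inducedAut A p0) : exists W, realizes W (val a).
Proof.
have /asboolP[T [h [h1 [h2 aE]]]] := valP a.
have [W hW] := word_of_path gen_enum (map (cseg A) h).
by exists W; apply/(realizesP h1 h2 _ (esym hW)).
Qed.

Lemma realizesM W X a b :
  realizes W a -> realizes X b -> realizes (W ++ X) (a * b).
Proof.
move=> Wa Xb w c cE; have [d dE] := conj_lift X w.
rewrite -[LHS]/(a (b (loop_class w))) (Xb _ _ dE); apply: Wa.
by rewrite cE dE map_cat pathV_cat -!catA.
Qed.

Lemma realizes_closed W a : closed_word B gen W -> realizes W a -> a = 1.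
Proof.
move=> Wc Wa; have [h [T [h1 h2 hW]]] := word_deck W.
have [d [dE d1]] := (closed_word_null h1 hW).1 Wc.
apply: aut_eqP => x /=; have [w ->] := loop_class_surj x.
rewrite (Wa w (loop_cat d (loop_cat w (loop_inv d)))).
  by rewrite !loop_classM loop_class_inv d1 invg1 mul1g mulg1.
by rewrite /= !map_cat cseg_pathV dE hW.
Qed.

Hypothesis inner_identity : forall (T : deck A) (a : automorphism (pi1 p0)),
  induces T a -> inner a -> is_identity T.
Hypothesis trivial_center :
  center (covering_subgroup A A' p0 gen) = [set 1]%classic.

(** The two hypotheses of the theorem act in turn: the first makes the lift of
    [W] a loop, the second makes its class, which is central, trivial. *)
Lemma closed_word_of_realizes1 W : realizes W 1 -> closed_word B gen W.
Proof.
move=> W1; have [h [T [h1 h2 hW]]] := word_deck W.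
have hE := (realizesP h1 h2 1 hW).1 W1.
have [T1 T2] : is_identity T.
  apply: (inner_identity (a := 1)); first by exists h, h1, h2.
  by exists 1 => x; rewrite mul1g invg1 mulg1.
have h_closed : is_closed p0 h by rewrite /is_closed h1 h2 T1 /=.
pose g : loop p0 := Sub h h_closed.
have g_central w : commute (loop_class g) (loop_class w).
  have wE : loop_class w = loop_class g * loop_class w * (loop_class g)^-1.
    rewrite -mulgA -loop_class_inv -(loop_classM w) -loop_classM; apply: W1.
    by rewrite /= !map_cat cseg_pathV hW.
  by rewrite /commute [in RHS]wE mulgVK.
apply/(principal_class1 _ _ Cs_point).
suff : center (covering_subgroup A A' p0 gen) (principal_class B gen W).
  by rewrite trivial_center.
split.
  have [k k0] := cpoint_surj A' p0; have hk := h1; rewrite -k0 in hk.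
  have [u [pu uh]] := path_lift_ex hk.
  exists k, u, W; split=> //; last by rewrite map_comp_cov uh.
  by rewrite -image_endpoint uh k0 h2 T1.
move=> _ [p [u [X [pu p_over end_over Xu ->]]]].
pose x := map (cseg A') u.
have x_closed : is_closed p0 x.
  rewrite -p_over /is_closed image_path //= image_endpoint end_over p_over.
  exact: eqxx.
pose y : loop p0 := Sub x x_closed.
rewrite /commute -!principal_classM; apply/(principal_classP _ _ Cs_point).
pose e := loop_cat (loop_cat g y) (loop_inv (loop_cat y g)).
have /andP[pe _] := valP e.
(* The word W X (X W)^-1 lies under the loop e = (g y) (y g)^-1, whose class is
   trivial because that of g is central. *)
apply/(closed_word_null pe); last first.
  exists e; split=> //; rewrite loop_classM loop_class_inv !loop_classM.
  by rewrite g_central mulgV.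
rewrite /= !map_cat cseg_pathV word_pathV !map_cat hW Xu.
by rewrite map_comp_cov.
Qed.

(** Both equalities say that [W X^-1] realizes the identity.  The automorphism
    realized by [X^-1] is [b^-1], because [X X^-1] is a closed word. *)
Lemma realizes_eq W X a b : realizes W a -> realizes X b ->
  a = b <-> principal_class B gen W = principal_class B gen X.
Proof.
move=> Wa Xb.
have [b' Xb'] := realizes_induced (wordV X).
have XX_closed : closed_word B gen (X ++ wordV X).
  by apply/(principal_classP _ _ Cs_point).
have bb' : b * val b' = 1 := realizes_closed XX_closed (realizesM Xb Xb').
have b'E : val b' = b^-1 by apply: (mulgI b); rewrite bb' mulgV.
have WX := realizesM Wa Xb'; rewrite b'E in WX.
split=> [ab | WX_eq].
  apply/(principal_classP _ _ Cs_point)/closed_word_of_realizes1.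
  by rewrite ab mulgV in WX.
apply: divg1_eq; apply: realizes_closed WX.
exact/(principal_classP _ _ Cs_point).
Qed.

End Realization.

Theorem mainTheorem5 :
  forall (C Cs : surfaceComplex) (A : covering C Cs) (p0 : pt C),
    connected C ->
    (exists q : pt Cs, forall q' : pt Cs, q' = q) ->
    boundary_determines_piece Cs ->
    regular A ->
  forall (K : surfaceComplex) (A' : covering K C),
    universal_covering A' ->
  forall (I : countType) (gen : I -> segment Cs),
    enumerates_segments gen ->
    (forall T : deck A, ~ is_identity T ->
       exists a : automorphism (pi1 p0), induces T a /\ ~ inner a) ->
    center (covering_subgroup A A' p0 gen) = [set 1%g]%classic ->
    isomorphic (inducedAut A p0) (principalGroup (comp_cov A A') gen).
Proof.
move=> C Cs A p0 C_conn [q0 q0P] _ A_reg K A' A'_univ I gen gen_enum outer_ex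
  center1.
have Cs_point (q q' : pt Cs) : q = q' by rewrite (q0P q) (q0P q').
have all_induce (T : deck A) : exists a : automorphism (pi1 p0), induces T a.
  have [T1 | /outer_ex[a [aT _]]] := EM (is_identity T); last by exists a.
  by exists 1; exact: induces_identity.
have inner_identity (T : deck A) (a : automorphism (pi1 p0)) :
    induces T a -> inner a -> is_identity T.
  move=> aT a_inner; apply: contrapT => /outer_ex[b [bT b_outer]].
  exact/b_outer/(induces_inner aT bT).
pose R (a : inducedAut A p0) (v : principalGroup (comp_cov A A') gen) :=
  exists W, v = principal_class (comp_cov A A') gen W /\
    realizes A gen W (val a).
apply: (@isomorphic_of_rel _ _ R).
- move=> a; have [W Wa] := induced_realizes gen_enum a.
  by exists (principal_class (comp_cov A A') gen W), W.
- move=> v; have [W ->] := principal_class_surj v.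
  have [a Wa] := realizes_induced C_conn Cs_point A_reg gen all_induce W.
  by exists a, W.
- move=> a _ b _ [W [-> Wa]] [X [-> Xb]].
  have E := realizes_eq C_conn Cs_point A_reg A'_univ all_induce inner_identity
    center1 Wa Xb.
  by split=> [ab | /E /val_inj //]; apply/E; rewrite ab.
- move=> a _ b _ [W [-> Wa]] [X [-> Xb]]; exists (W ++ X).
  by split; [rewrite principal_classM | rewrite valM; exact: realizesM].
Qed.
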